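(* Let $N\ge1$, $s\in(0,1)$, let $\mu_0\in\mathcal{M}^+_s$ and let $u(t,x)=\int_{\mathbb{R}^N}P^t(x-y)\,\mathrm{d}\mu_0(y)$ be the very weak solution of $\partial_t u+(-\Delta)^s u=0$ with initial measure $\mu_0$. Set $\|\mu_0\|_\Phi=\int_{\mathbb{R}^N}\Phi\,\mathrm{d}\mu_0$. There exists a constant $C=C(N,s)$ such that for every $t>0$ and $x\in\mathbb{R}^N$ $$u(t,x)\le C\,\|\mu_0\|_\Phi\,\big(t^{-N/(2s)}+t\big)\,(1+|x|)^{N+2s}.$$
   Context: $(-\Delta)^s$ denotes the fractional Laplacian on $\mathbb{R}^N$ (Fourier multiplier $|\xi|^{2s}$). $P^t$ ($t>0$) is the fractional heat kernel, the function on $\mathbb{R}^N$ whose Fourier transform is $e^{-t|\xi|^{2s}}$. The weight $\Phi$ is defined by $\Phi(x)=1$ for $|x|\le1$ and $\Phi(x)=(1+(|x|^2-1)^4)^{-(N+2s)/8}$ for $|x|\ge1$. $\mathcal{M}^+_s$ is the class of nonnegative Radon measures $\mu$ on $\mathbb{R}^N$ with $\int(1+|x|)^{-(N+2s)}\,\mathrm{d}\mu(x)<\infty$. *)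

(* Defs.v *)
From HB Require Import structures.
From mathcomp Require Import all_boot all_order all_algebra.
From mathcomp Require Import all_classical all_reals all_analysis.
Set Implicit Arguments. Unset Strict Implicit. Unset Printing Implicit Defensive.
Import Order.TTheory GRing.Theory Num.Theory.
Import numFieldNormedType.Exports.
Local Open Scope classical_set_scope.
Local Open Scope ring_scope.

(* R^N is modelled as N.-tuple R, with the library's product sigma-algebra
   (generated by the coordinate maps = Borel sigma-algebra of R^N). *)

Definition dotv (R : realType) (N : nat) (x y : N.-tuple R) : R :=
  \sum_(i < N) tnth x i * tnth y i.

Definition normv (R : realType) (N : nat) (x : N.-tuple R) : R :=
  Num.sqrt (\sum_(i < N) tnth x i ^+ 2).

Definition subv (R : realType) (N : nat) (x y : N.-tuple R) : N.-tuple R :=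
  [tuple tnth x i - tnth y i | i < N].

Definition is_lebesgue_measure (R : realType) (N : nat)
    (lam : {measure set (N.-tuple R) -> \bar R}) : Prop :=
  forall a b : N.-tuple R, (forall i, tnth a i <= tnth b i) ->
    lam [set x | forall i, tnth a i <= tnth x i <= tnth b i]
    = (\prod_(i < N) (tnth b i - tnth a i))%:E.

(* Fractional heat kernel P^t, defined through Fourier inversion of
   exp(-t |xi|^{2s}):  P^t(x) = (2 pi)^{-N} \int e^{i x.xi} e^{-t|xi|^{2s}} dxi.
   The integrand is even in xi, so the imaginary part vanishes and
   e^{i x.xi} may be replaced by cos (x.xi). *)
Definition frac_heat_kernel (R : realType) (N : nat)
    (lam : {measure set (N.-tuple R) -> \bar R}) (s t : R) (x : N.-tuple R) : R :=
  ((2 * pi)^-1) ^+ N *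
  Rintegral lam [set: N.-tuple R]
    (fun xi => cos (dotv x xi) * expR (- (t * (normv xi) `^ (2 * s)))).

Definition Phi (R : realType) (N : nat) (s : R) (x : N.-tuple R) : R :=
  if normv x <= 1 then 1
  else (1 + (normv x ^+ 2 - 1) ^+ 4) `^ (- ((N%:R + 2 * s) / 8)).

Definition in_Ms_plus (R : realType) (N : nat) (s : R)
    (mu : {measure set (N.-tuple R) -> \bar R}) : Prop :=
  (forall r : R, (mu [set x | (normv x <= r)%R] < +oo)%E) /\
  (\int[mu]_(x in [set: N.-tuple R])
      ((1 + normv x) `^ (- (N%:R + 2 * s)))%:E < +oo)%E.

Definition frac_heat_sol (R : realType) (N : nat)
    (lam mu0 : {measure set (N.-tuple R) -> \bar R}) (s t : R) (x : N.-tuple R)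
    : \bar R :=
  \int[mu0]_(y in [set: N.-tuple R]) (frac_heat_kernel lam s t (subv x y))%:E.

Definition Phi_norm (R : realType) (N : nat) (s : R)
    (mu0 : {measure set (N.-tuple R) -> \bar R}) : \bar R :=
  \int[mu0]_(y in [set: N.-tuple R]) (Phi s y)%:E.

(* Main.v *)
(* Two bounds on the kernel P^t are combined: P^t(z) <= A t^(-N/(2s)) and
   P^t(z) <= B t |z|^(-(N+2s)).  They give P^t(z) <= C (t^(-N/(2s)) + t) (1+|z|)^(-(N+2s)),
   and 1+|y| <= (1+|x|)(1+|x-y|) together with (1+|y|)^(-(N+2s)) <= Phi(y) moves
   the weight from x-y to y.
   The tail bound uses finite differences instead of integration by parts.
   For h = pi z/|z|^2, translating by h flips the sign of cos(z.xi), so that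
   (-2)^k int cos(z.xi) m(xi) dxi = int cos(z.xi) (Delta_h^k m)(xi) dxi.
   For m(xi) = exp(-t|xi|^(2s)) and k = N+3, the mean value theorem along the
   line xi + u h gives |Delta_h^k m(xi)| <= C t |h|^(2s) (1+|xi|/|h|)^(-(N+1)),
   whose integral is at most C' t |h|^(N+2s). *)
Require Import Defs.
From HB Require Import structures.
From mathcomp Require Import all_boot all_order all_algebra.
From mathcomp Require Import all_classical all_reals all_analysis.
From mathcomp Require Import measurable_realfun ring lra.
Set Implicit Arguments. Unset Strict Implicit. Unset Printing Implicit Defensive.
Import Order.TTheory GRing.Theory Num.Theory.
Import numFieldNormedType.Exports.
Local Open Scope classical_set_scope.
Local Open Scope ring_scope.

(** * Higher derivatives and finite differences on the line *)

Section calculus.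
Variable R : realType.
Implicit Types f g : R -> R.

(** One term of the exponential series. It absorbs the powers of t q^s produced by derivatives and
    gives the decay of the symbol. *)
Lemma expR_ge_exprn (x : R) (n : nat) : 0 <= x -> x ^+ n <= n`!%:R * expR x.
Proof.
case: n => [|n] x0; first by rewrite expr0 fact0 mul1r -expR0 ler_expR.
rewrite mulrC -ler_pdivrMr ?ltr0n ?fact_gt0//.
by apply: le_trans (expR_ge1Dxn n x0); rewrite lerDr.
Qed.

Lemma ler_powR_neg (a b r : R) : 0 < a -> a <= b -> r <= 0 -> b `^ r <= a `^ r.
Proof.
move=> a0 ab r0; have b0 := lt_le_trans a0 ab.
rewrite -(opprK r) !(powRN _ (- r)) lef_pV2 ?posrE ?powR_gt0//.
by apply: ge0_ler_powR; rewrite ?oppr_ge0 ?nnegrE//; apply: ltW.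
Qed.

Lemma powRD_pos (x r s : R) : 0 < x -> x `^ (r + s) = x `^ r * x `^ s.
Proof. by move=> x0; rewrite powRD// (gt_eqF x0) implybT. Qed.

Lemma is_derive_mul f g (x df dg : R) :
  is_derive x 1 f df -> is_derive x 1 g dg ->
  is_derive x 1 (fun y => f y * g y) (f x * dg + g x * df).
Proof. by move=> hf hg; have := is_deriveM hf hg. Qed.

Lemma is_derive_scale (k : R) f (x df : R) : is_derive x 1 f df ->
  is_derive x 1 (fun y => k * f y) (k * df).
Proof. by move=> hf; exact: (is_deriveZ k hf). Qed.

Lemma is_derive_exprn f (n : nat) (x df : R) : is_derive x 1 f df ->
  is_derive x 1 (fun y => f y ^+ n) (n%:R * f x ^+ n.-1 * df).
Proof.
move=> hf; have := is_deriveX n hf.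
by rewrite (_ : f ^+ n = fun y => f y ^+ n)//; apply/funext => y; rewrite exprfctE.
Qed.

Lemma is_derive_affine (a b x : R) : is_derive x 1 (fun u => a + u * b) b.
Proof.
have h1 : is_derive x (1 : R) (fun=> a) 0 := is_derive_cst _ _ _.
have h2 : is_derive x (1 : R) (fun=> b) 0 := is_derive_cst _ _ _.
have h3 : is_derive x (1 : R) (fun u : R => u) 1 := is_derive_id _ _.
have h := is_deriveD h1 (is_derive_mul h3 h2).
by apply: (is_derive_eq h); ring.
Qed.

Lemma is_derive_quadratic (a b c x : R) :
  is_derive x 1 (fun u => a + u * b + u ^+ 2 * c) (b + 2 * x * c).
Proof.
have h2 : is_derive x (1 : R) (fun=> c) 0 := is_derive_cst _ _ _.
have h3 : is_derive x (1 : R) (fun u : R => u) 1 := is_derive_id _ _.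
have h := is_deriveD (is_derive_affine a b x)
  (is_derive_mul (is_derive_exprn 2 h3) h2).
by apply: (is_derive_eq h); rewrite expr1; ring.
Qed.

Definition diff1 f : R -> R := fun x => f (x + 1) - f x.

(** A chain of k successive derivatives on [a, b], given by witnesses, whose last member is bounded
    by [M]. The derivatives are two-sided even at the endpoints; the recursive form makes sums and
    differences a matter of induction. *)
Fixpoint deriv_bound (k : nat) (a b M : R) f : Prop :=
  if k is k'.+1 then
    exists2 g, (forall x, a <= x <= b -> is_derive x 1 f (g x)) & deriv_bound k' a b M g
  else forall x, a <= x <= b -> `|f x| <= M.

Lemma deriv_boundD k a b M1 M2 f g : deriv_bound k a b M1 f -> deriv_bound k a b M2 g ->
  deriv_bound k a b (M1 + M2) (fun x => f x + g x).
Proof.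
elim: k f g => [|k IH] f g /=.
  by move=> h1 h2 x xab; apply: (le_trans (ler_normD _ _)); rewrite lerD ?h1 ?h2.
move=> [df hf h1] [dg hg h2]; exists (fun x => df x + dg x); last exact: IH.
by move=> x xab; exact: is_deriveD (hf _ xab) (hg _ xab).
Qed.

Lemma deriv_boundS k a b M M' f : M <= M' -> deriv_bound k a b M f -> deriv_bound k a b M' f.
Proof.
move=> MM'; elim: k f => [|k IH] f /=.
  by move=> h x /h /le_trans; apply.
by move=> [g hg h]; exists g => //; apply: IH.
Qed.

Lemma is_derive_shift f (x df : R) : is_derive (x + 1) 1 f df ->
  is_derive x 1 (fun y => f (y + 1)) df.
Proof.
move=> hf; have h : is_derive x 1 (fun y : R => y + 1) (1 + 0).
  exact: is_deriveD (is_derive_id _ _) (is_derive_cst _ _ _).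
by have := @is_derive1_comp _ f (fun y => y + 1) x df (1 + 0) hf h; rewrite addr0 mulr1.
Qed.

(** One unit difference consumes one derivative and one unit of the interval. For the last
    derivative this is the mean value theorem; before that, differencing commutes with
    differentiation. *)
Lemma deriv_bound_diff1 k a b M f :
  deriv_bound k.+1 a (b + 1) M f -> deriv_bound k a b M (diff1 f).
Proof.
elim: k f => [|k IH] f.
  move=> /= [g hg hM] x /andP[ax xb].
  have I y : x <= y <= x + 1 -> a <= y <= b + 1.
    by move=> /andP[xy yx]; apply/andP; split; lra.
  have xx1 : x < x + 1 by rewrite ltrDl.
  have h y : y \in `]x, x + 1[ -> is_derive y 1 f (g y).
    by rewrite in_itv/= => /andP[xy yx]; apply: hg; apply: I; rewrite !ltW.
  have cf : {within `[x, x + 1], continuous f}.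
    apply: derivable_within_continuous => y.
    by rewrite in_itv/= => /I yI; have [] := hg _ yI.
  have [c] := MVT xx1 h cf.
  rewrite in_itv/= /diff1 => /andP[c1 c2] ->.
  by rewrite addrAC subrr add0r mulr1; apply: hM; apply: I; rewrite !ltW.
move=> [g hg hM]; exists (diff1 g); last exact: IH.
move=> x /andP[ax xb]; rewrite /diff1.
apply: is_deriveB.
  by apply: is_derive_shift; apply: hg; apply/andP; split; lra.
by apply: hg; apply/andP; split; lra.
Qed.

Lemma iter_diff1_deriv_bound k a M f : deriv_bound k a (a + k%:R) M f ->
  `|iter k diff1 f a| <= M.
Proof.
elim: k f => [|k IH] f; first by move=> /= h; apply: h; rewrite addr0 lexx.
move=> h; rewrite iterSr; apply: IH; apply: deriv_bound_diff1.
by rewrite -addrA natr1.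
Qed.

(** The triangle inequality doubles the bound at each difference. No smoothness is involved, which
    suits the neighbourhood of the origin. *)
Lemma iter_diff1_le k a M f :
  (forall x, a <= x <= a + k%:R -> `|f x| <= M) ->
  `|iter k diff1 f a| <= 2 ^+ k * M.
Proof.
elim: k f M => [|k IH] f M h.
  by rewrite expr0 mul1r; apply: h; rewrite addr0 lexx.
rewrite iterSr exprSr -mulrA; apply: IH => x /andP[ax xk].
have xk' : x + 1 <= a + k.+1%:R by rewrite -natr1; lra.
rewrite mulr_natl mulr2n; apply: (le_trans (ler_normB _ _)).
by apply: lerD; apply: h; apply/andP; split; lra.
Qed.

End calculus.

(** * Derivatives of exp(-t q^s) for a quadratic q *)

Section derivatives.
Variable R : realType.
Variable s : R.
Hypothesis s01 : 0 < s < 1.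

(* The derivatives of [exp (- t q^s)] for a quadratic [q], with [q' = q1] and
   constant [q'' = q2], are sums of such terms. *)
Definition dterm (c : R) (j l p : nat) (t : R) (q q1 : R -> R) (q2 : R) (x : R) : R :=
  c * t ^+ j * q x `^ (s * j%:R - (l + p)%:R) * q1 x ^+ l * q2 ^+ p *
  expR (- (t * q x `^ s)).

Lemma is_derive_powR_comp (q : R -> R) (a x dq : R) : 0 < q x ->
  is_derive x 1 q dq ->
  is_derive x 1 (fun y => q y `^ a) (a * q x `^ (a - 1) * dq).
Proof. by move=> q0 hq; have := is_derive1_comp (is_derive1_powR a q0) hq. Qed.

Lemma is_derive_expR_powR (t : R) (q : R -> R) (x dq : R) : 0 < q x ->
  is_derive x 1 q dq ->
  is_derive x 1 (fun y => expR (- (t * q y `^ s)))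
    (expR (- (t * q x `^ s)) * (- (t * (s * q x `^ (s - 1) * dq)))).
Proof.
move=> q0 hq.
have h : is_derive x 1 (fun y => - (t * q y `^ s)) (- (t * (s * q x `^ (s - 1) * dq))).
  by apply: is_deriveN; exact: is_derive_scale (is_derive_powR_comp s q0 hq).
by have := is_derive1_comp (is_derive_expR _) h.
Qed.

(** Product rule: the three terms come from the power of [q], from [q1 ^+ l] and from the
    exponential. Each term that does not vanish raises [l + p.*2] by one. *)
Lemma is_derive_dterm (c : R) j l p (t : R) (q q1 : R -> R) (q2 x : R) : 0 < q x ->
  is_derive x 1 q (q1 x) -> is_derive x 1 q1 q2 ->
  is_derive x 1 (dterm c j l p t q q1 q2)
    (dterm (c * (s * j%:R - (l + p)%:R)) j l.+1 p t q q1 q2 x +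
     dterm (c * l%:R) j l.-1 p.+1 t q q1 q2 x +
     dterm (- c * s) j.+1 l.+1 p t q q1 q2 x).
Proof.
move=> q0 hq hq1; rewrite /dterm.
have h1 := is_derive_powR_comp (s * j%:R - (l + p)%:R) q0 hq.
have h2 := is_derive_exprn l hq1.
have h3 := is_derive_mul (is_derive_scale (c * t ^+ j) h1) h2.
have h4 := is_derive_mul h3 (is_derive_cst (q2 ^+ p) x 1).
have h5 := is_derive_mul h4 (is_derive_expR_powR t q0 hq).
apply: (is_derive_eq h5) => {h1 h2 h3 h4 h5}; rewrite /cst.
set E := expR _; set e := s * j%:R - (l + p)%:R.
have -> : s * j%:R - (l.+1 + p)%:R = e - 1.
  by rewrite /e addSn -natr1; ring.
have -> : q x `^ (s * j.+1%:R - (l.+1 + p)%:R) = q x `^ e * q x `^ (s - 1).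
  by rewrite -powRD_pos//; congr (_ `^ _); rewrite /e addSn -!natr1; ring.
(* For [l = 0] the truncated predecessor is harmless, since the middle term has coefficient 0. *)
case: l @e => [|l] e /=.
  by rewrite !exprS !expr0; ring.
have -> : s * j%:R - (l + p.+1)%:R = e by rewrite /e addSnnS.
by rewrite !exprS; ring.
Qed.

(** Of the j + 1 factors t q^s, one is kept and j are absorbed by the exponential, since v^j e^(-v)
    <= j!. Each [q1] costs 2 eta q^(1/2) and each [q2] costs 2 eta^2. *)
Lemma dterm_le (c : R) j l p (t : R) (q q1 : R -> R) (q2 eta x : R) :
  0 < t -> 0 < q x -> 0 <= eta ->
  `|q1 x| <= 2 * eta * q x `^ 2^-1 -> `|q2| <= 2 * eta ^+ 2 ->
  `|dterm c j.+1 l p t q q1 q2 x| <= `|c| * 2 ^+ (l + p) * j`!%:R *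
    (t * eta ^+ (l + p.*2) * q x `^ (s - (l + p.*2)%:R / 2)).
Proof.
move=> t0 q0 eta0 hq1 hq2; rewrite /dterm !normrM.
rewrite (ger0_norm (expR_ge0 _)) (ger0_norm (powR_ge0 _ _)) !normrX (gtr0_norm t0).
set E := expR _.
(* The last factor q^(-l/2) is split off to cancel the q^(l/2) that comes from bounding
   [q1 ^+ l]. *)
have -> : q x `^ (s * j.+1%:R - (l + p)%:R) =
    (q x `^ s) ^+ j * (q x `^ (s - (l + p.*2)%:R / 2) * q x `^ (- (l%:R / 2))).
  rewrite -powR_mulrn ?powR_ge0// -powRrM -!powRD_pos//; congr (_ `^ _).
  rewrite -natr1 !natrD -muln2 natrM; lra.
apply: (@le_trans _ _ (`|c| * t ^+ j.+1 *
    ((q x `^ s) ^+ j * (q x `^ (s - (l + p.*2)%:R / 2) * q x `^ (- (l%:R / 2)))) *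
    (2 * eta * q x `^ 2^-1) ^+ l * (2 * eta ^+ 2) ^+ p * E)).
  have t0' := ltW t0.
  rewrite ler_wpM2r ?expR_ge0//; apply: ler_pM.
  - by rewrite !mulr_ge0 ?exprn_ge0 ?powR_ge0.
  - by rewrite exprn_ge0.
  - rewrite ler_wpM2l ?mulr_ge0 ?powR_ge0 ?exprn_ge0 ?powR_ge0//.
    by rewrite lerXn2r ?nnegrE ?mulr_ge0 ?powR_ge0.
  - by rewrite lerXn2r ?nnegrE ?mulr_ge0 ?exprn_ge0 ?powR_ge0.
have hl : (q x `^ 2^-1) ^+ l * q x `^ (- (l%:R / 2)) = 1.
  rewrite -powR_mulrn ?powR_ge0// -powRrM -powRD_pos//.
  by rewrite (_ : _ + _ = 0) ?powRr0//; lra.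
have hE : (t * q x `^ s) ^+ j * E <= j`!%:R.
  have u0 : 0 <= t * q x `^ s by rewrite mulr_ge0 ?powR_ge0 ?ltW.
  by rewrite /E expRN ler_pdivrMr ?expR_gt0// expR_ge_exprn.
set A := q x `^ (s - _) in hl *; set B := q x `^ s in hE *.
set D := q x `^ (- _) in hl *; set F := q x `^ 2^-1 in hl *.
rewrite [leLHS](_ : _ = `|c| * 2 ^+ (l + p) * ((t * B) ^+ j * E) *
  (t * eta ^+ (l + p.*2) * A) * (F ^+ l * D)); last first.
  rewrite (exprD eta) -mul2n (exprM eta) (exprD 2) !exprMn exprS; ring.
rewrite hl mulr1 ler_wpM2r ?mulr_ge0 ?exprn_ge0 ?powR_ge0 ?(ltW t0)//.
by rewrite ler_wpM2l ?mulr_ge0 ?exprn_ge0.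
Qed.

(* The bound on [q1] is what Cauchy-Schwarz gives for [q u = |xi + u h|^2] and
   [eta = |h|]. *)
Lemma deriv_bound_dterm k (c : R) j l p : exists C : R, 0 <= C /\
  forall (t : R) (q q1 : R -> R) (q2 eta m a b : R),
    0 < t -> 0 <= eta -> 0 < m ->
    (forall x, a <= x <= b -> [/\ m <= q x, is_derive x 1 q (q1 x),
       is_derive x 1 q1 q2 & `|q1 x| <= 2 * eta * q x `^ 2^-1]) ->
    `|q2| <= 2 * eta ^+ 2 ->
    s <= (k + (l + p.*2))%:R / 2 ->
    deriv_bound k a b (C * (t * eta ^+ (k + (l + p.*2)) *
                     m `^ (s - (k + (l + p.*2))%:R / 2)))
      (dterm c j.+1 l p t q q1 q2).
Proof.
elim: k c j l p => [|k IH] c j l p.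
  exists (`|c| * 2 ^+ (l + p) * j`!%:R); split; first by rewrite !mulr_ge0 ?exprn_ge0.
  move=> t q q1 q2 eta m a b t0 eta0 m0 hq hq2 hs x /hq[mq _ _ hq1] /=.
  have q0 := lt_le_trans m0 mq.
  apply: (le_trans (dterm_le _ _ _ _ t0 q0 eta0 hq1 hq2)).
  rewrite ler_wpM2l ?mulr_ge0 ?exprn_ge0// ler_wpM2l ?mulr_ge0 ?exprn_ge0 ?(ltW t0)//.
  (* The exponent of [q x] is nonpositive by [hs], so the lower bound [m] may replace [q x]. *)
  by rewrite ler_powR_neg// subr_le0.
have [C1 [C10 h1]] := IH (c * (s * j.+1%:R - (l + p)%:R)) j l.+1 p.
have [C2 [C20 h2]] := IH (c * l%:R) j l.-1 p.+1.
have [C3 [C30 h3]] := IH (- c * s) j.+1 l.+1 p.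
have e1 : (k + (l.+1 + p.*2) = k.+1 + (l + p.*2))%N by rewrite addSn addnS.
exists (C1 + C2 + C3); split; first by rewrite !addr_ge0.
move=> t q q1 q2 eta m a b t0 eta0 m0 hq hq2 hs.
exists (fun x => dterm (c * (s * j.+1%:R - (l + p)%:R)) j.+1 l.+1 p t q q1 q2 x +
     dterm (c * l%:R) j.+1 l.-1 p.+1 t q q1 q2 x +
     dterm (- c * s) j.+2 l.+1 p t q q1 q2 x).
  move=> x /hq[mq hq' hq1 _]; apply: is_derive_dterm => //.
  exact: lt_le_trans m0 mq.
rewrite !mulrDl; apply: deriv_boundD; first apply: deriv_boundD.
- by rewrite -e1; apply: h1 => //; rewrite e1.
(* For [l = 0] the count [l + p.*2] of the middle term does not match, but that term is identically
   zero and is bounded separately. *)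
- case: l {h1 h3 IH} e1 hs h2 => [|l] e1 hs h2; last first.
    have e2 : (k + (l + p.+1.*2) = k.+1 + (l.+1 + p.*2))%N.
      by rewrite doubleS !(addnS, addSn).
    by rewrite -e2; apply: h2 => //; rewrite e2.
  have -> : dterm (c * 0%:R) j.+1 0.-1 p.+1 t q q1 q2 = fun=> 0.
    by apply/funext => x; rewrite /dterm mulr0 !mul0r.
  apply: (@deriv_boundS _ _ _ _ 0).
    by rewrite !mulr_ge0 ?exprn_ge0 ?powR_ge0// ltW.
  elim: k {e1 hs h2} => [|k IH] /=; first by move=> x _; rewrite normr0.
  by exists (fun=> 0) => // x _; exact: is_derive_cst.
- by rewrite -e1; apply: h3 => //; rewrite e1.
Qed.

(** The first derivative is a single [dterm] with j = l = 1 and p = 0; the other k - 1 come from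
    [deriv_bound_dterm]. At least two derivatives are taken so that s - k/2 is nonpositive, as s <
    1. *)
Lemma deriv_bound_expR_powR k : (1 < k)%N -> exists C : R, 0 <= C /\
  forall (t : R) (q q1 : R -> R) (q2 eta m a b : R),
    0 < t -> 0 <= eta -> 0 < m ->
    (forall x, a <= x <= b -> [/\ m <= q x, is_derive x 1 q (q1 x),
       is_derive x 1 q1 q2 & `|q1 x| <= 2 * eta * q x `^ 2^-1]) ->
    `|q2| <= 2 * eta ^+ 2 ->
    deriv_bound k a b (C * (t * eta ^+ k * m `^ (s - k%:R / 2)))
      (fun x => expR (- (t * q x `^ s))).
Proof.
case: k => [//|k] k0.
have [C [C0 h]] := deriv_bound_dterm k (- s) 0 1 0.
exists C; split => // t q q1 q2 eta m a b t0 eta0 m0 hq hq2.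
exists (dterm (- s) 1 1 0 t q q1 q2).
  move=> x /hq[mq hq' _ _]; have q0 := lt_le_trans m0 mq.
  apply: (is_derive_eq (is_derive_expR_powR t q0 hq')).
  have e : s * 1%:R - (1 + 0)%:R = s - 1 by rewrite addn0 mulr1.
  by rewrite /dterm e !expr1 expr0; ring.
have := h t q q1 q2 eta m a b t0 eta0 m0 hq hq2.
rewrite addn1; apply.
case/andP: s01 => _ /ltW s1; apply: (le_trans s1).
by rewrite ler_pdivlMr// mul1r ler_nat.
Qed.

End derivatives.

(** * Finite differences of the symbol *)

(** Homogeneity of the symbol: t^(-1/(2s)) is the natural frequency scale at time t. *)
Lemma powR_div_scale (R : realType) (s t a : R) : 0 < s -> 0 < t -> 0 <= a ->
  (a / t `^ (- (2 * s)^-1)) `^ (2 * s) = t * a `^ (2 * s).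
Proof.
move=> s0 t0 a0; have s20 : 2 * s != 0 by rewrite gt_eqF// mulr_gt0.
rewrite powRN invrK powRM ?powR_ge0// -powRrM mulVf//.
by rewrite powRr1 ?(ltW t0)// mulrC.
Qed.

(** * Euclidean geometry, differences along a direction, decay of the symbol *)

Section vectors.
Variables (R : realType) (N : nat).
Implicit Types x y h xi : N.-tuple R.

Definition shiftv x (tau : R) h : N.-tuple R :=
  [tuple tnth x i + tau * tnth h i | i < N].

Lemma normv_ge0 x : 0 <= normv x.
Proof. exact: sqrtr_ge0. Qed.

Lemma sqr_normv x : normv x ^+ 2 = \sum_(i < N) tnth x i ^+ 2.
Proof. by rewrite sqr_sqrtr// sumr_ge0// => i _; rewrite sqr_ge0. Qed.

(** Cauchy-Schwarz through Lagrange's identity: the double sum of (x_i y_j - x_j y_i)^2 equals 2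
    (|x|^2 |y|^2 - (x.y)^2). *)
Lemma ler_dotv x y : `|dotv x y| <= normv x * normv y.
Proof.
rewrite -ler_sqr ?nnegrE ?mulr_ge0 ?normv_ge0// exprMn !sqr_normv.
rewrite real_normK ?num_real// /dotv.
set S := _ ^+ 2.
have : 0 <= \sum_(i < N) \sum_(j < N)
    (tnth x i * tnth y j - tnth x j * tnth y i) ^+ 2.
  by apply: sumr_ge0 => i _; apply: sumr_ge0 => j _; exact: sqr_ge0.
have -> : \sum_(i < N) \sum_(j < N)
    (tnth x i * tnth y j - tnth x j * tnth y i) ^+ 2 =
  \sum_(i < N) \sum_(j < N) tnth x i ^+ 2 * tnth y j ^+ 2 +
  \sum_(i < N) \sum_(j < N) tnth y i ^+ 2 * tnth x j ^+ 2 -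
  2 * \sum_(i < N) \sum_(j < N) (tnth x i * tnth y i) * (tnth x j * tnth y j).
  rewrite -big_split/= mulr_sumr -sumrB; apply: eq_bigr => i _.
  rewrite -big_split/= mulr_sumr -sumrB; apply: eq_bigr => j _; ring.
rewrite -!big_distrlr/= -expr2 -/S.
rewrite (mulrC (\sum_(i < N) tnth y i ^+ 2)); lra.
Qed.

Lemma sqr_normv_shiftv x tau h : normv (shiftv x tau h) ^+ 2 =
  normv x ^+ 2 + tau * (2 * dotv x h) + tau ^+ 2 * normv h ^+ 2.
Proof.
rewrite !sqr_normv /dotv !mulr_sumr -!big_split/=; apply: eq_bigr => i _.
by rewrite tnth_mktuple; ring.
Qed.

Lemma dotv_shiftv x y tau h : dotv x (shiftv y tau h) = dotv x y + tau * dotv x h.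
Proof.
rewrite /dotv mulr_sumr -big_split/=; apply: eq_bigr => i _.
by rewrite tnth_mktuple; ring.
Qed.

Lemma dotvC x y : dotv x y = dotv y x.
Proof. by apply: eq_bigr => i _; rewrite mulrC. Qed.

Lemma dotvv x : dotv x x = normv x ^+ 2.
Proof. by rewrite sqr_normv; apply: eq_bigr => i _; rewrite expr2. Qed.

Lemma normv_shiftv_le x tau h :
  normv (shiftv x tau h) <= normv x + `|tau| * normv h.
Proof.
rewrite -ler_sqr ?nnegrE ?addr_ge0 ?mulr_ge0 ?normv_ge0//.
rewrite sqr_normv_shiftv sqrrD exprMn real_normK ?num_real// lerD2r lerD2l.
apply: (le_trans (ler_norm _)); rewrite !normrM (ger0_norm (ler0n _ 2)) mulrCA.
by rewrite -(mulr_natl (_ * _)) ler_wpM2l// [leRHS]mulrCA ler_wpM2l ?ler_dotv.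
Qed.

Lemma shiftvA x tau tau' h : shiftv (shiftv x tau h) tau' h = shiftv x (tau + tau') h.
Proof. by apply: eq_from_tnth => i; rewrite !tnth_mktuple mulrDl addrA. Qed.

Lemma shiftv0 x h : shiftv x 0 h = x.
Proof. by apply: eq_from_tnth => i; rewrite !tnth_mktuple mul0r addr0. Qed.

Lemma normv_shiftv_ge x tau h :
  normv x - `|tau| * normv h <= normv (shiftv x tau h).
Proof.
rewrite lerBlDr -{1}(shiftv0 x h) -(subrr tau) -shiftvA.
by rewrite -(normrN tau) normv_shiftv_le.
Qed.

Lemma normv_scale (c : R) x : normv [tuple c * tnth x i | i < N] = `|c| * normv x.
Proof.
rewrite /normv -sqrtr_sqr -sqrtrM ?sqr_ge0//; congr Num.sqrt.
by rewrite mulr_sumr; apply: eq_bigr => i _; rewrite tnth_mktuple exprMn.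
Qed.

Lemma dotv_scale (c : R) x y : dotv x [tuple c * tnth y i | i < N] = c * dotv x y.
Proof.
by rewrite /dotv mulr_sumr; apply: eq_bigr => i _; rewrite tnth_mktuple mulrCA.
Qed.

Definition fdiffv h (F : N.-tuple R -> R) : N.-tuple R -> R :=
  fun xi => F (shiftv xi 1 h) - F xi.

(** Reduces differences in direction h to unit differences in one real variable, where the bounds on
    the line apply. *)
Lemma iter_fdiffv k h F xi tau : iter k (fdiffv h) F (shiftv xi tau h) =
  iter k (@diff1 R) (fun u => F (shiftv xi u h)) tau.
Proof.
elim: k F => [//|k IH] F; rewrite !iterSr IH; congr (iter k _ _ _).
by apply/funext => u; rewrite /fdiffv /diff1 shiftvA.
Qed.

Definition symb (s t : R) xi : R := expR (- (t * normv xi `^ (2 * s))).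

Lemma symbE s t xi : symb s t xi = expR (- (t * (normv xi ^+ 2) `^ s)).
Proof. by rewrite /symb powRrM powR_mulrn ?normv_ge0. Qed.

Lemma symb_ge0 s t xi : 0 <= symb s t xi. Proof. exact: expR_ge0. Qed.

Lemma symb_le1 s t xi : 0 <= t -> symb s t xi <= 1.
Proof. by move=> t0; rewrite -expR0 ler_expR oppr_le0 mulr_ge0 ?powR_ge0. Qed.

(* A power of the Japanese bracket of [xi / r]. *)
Definition jap (r : R) xi : R := (1 + normv xi / r) ^- N.+1.

Lemma jap_base_ge1 (r : R) xi : 0 < r -> 1 <= 1 + normv xi / r.
Proof. by move=> r0; rewrite lerDl divr_ge0 ?normv_ge0 ?ltW. Qed.

Lemma jap_gt0 (r : R) xi : 0 < r -> 0 < jap r xi.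
Proof.
by move=> r0; rewrite invr_gt0 exprn_gt0// (lt_le_trans ltr01)// jap_base_ge1.
Qed.

Lemma symb_scale (s t : R) xi : 0 < s -> 0 < t ->
  symb s t xi = expR (- ((normv xi / t `^ (- (2 * s)^-1)) `^ (2 * s))).
Proof. by move=> s0 t0; rewrite powR_div_scale ?normv_ge0. Qed.

(** With r = t^(-1/(2s)) and v = |xi|/r the symbol is exp(-v^(2s)), which decays faster than any
    power of v. *)
Lemma symb_le_jap (s : R) : 0 < s -> exists C : R, 0 <= C /\
  forall (t : R) xi, 0 < t -> symb s t xi <= C * jap (t `^ (- (2 * s)^-1)) xi.
Proof.
(* [n] is chosen so that v^(2sn) dominates v^(N+1) for v >= 1. *)
move=> s0; pose n := (Num.truncn (N.+1%:R / (2 * s))).+1.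
have hn : N.+1%:R / (2 * s) <= n%:R by rewrite ltW// truncnS_gt.
clearbody n.
exists (2 ^+ N.+1 * n`!%:R); split; first by rewrite mulr_ge0 ?exprn_ge0.
move=> t xi t0; set r := t `^ _; have r0 : 0 < r by rewrite powR_gt0.
have s20 : 2 * s != 0 by rewrite gt_eqF// mulr_gt0.
rewrite /jap ler_pdivlMr; last by rewrite exprn_gt0// (lt_le_trans ltr01)// jap_base_ge1.
set v := normv xi / r; have v0 : 0 <= v by rewrite divr_ge0 ?normv_ge0 ?ltW.
rewrite (symb_scale _ s0 t0) -/r -/v.
clearbody v.
rewrite expRN mulrC ler_pdivrMr ?expR_gt0//.
have n1 : 1 <= n`!%:R :> R by rewrite ler1n fact_gt0.
have [v1|v1] := leP v 1.
  apply: (@le_trans _ _ (2 ^+ N.+1 * 1 * 1)).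
    by rewrite !mulr1 lerXn2r ?nnegrE ?addr_ge0//; lra.
  rewrite ler_pM ?mulr_ge0 ?exprn_ge0// ?ler_wpM2l ?exprn_ge0//.
  by rewrite -expR0 ler_expR powR_ge0.
apply: (@le_trans _ _ (2 ^+ N.+1 * (v `^ (2 * s)) ^+ n)); last first.
  by rewrite -mulrA ler_wpM2l ?exprn_ge0// expR_ge_exprn// powR_ge0.
apply: (@le_trans _ _ ((2 * v) ^+ N.+1)).
  by rewrite lerXn2r ?nnegrE ?addr_ge0 ?mulr_ge0//; lra.
rewrite exprMn ler_wpM2l ?exprn_ge0// -(powR_mulrn n) ?powR_ge0// -(powR_mulrn N.+1)//.
rewrite -powRrM ler_powR ?(ltW v1)//.
by move: hn; rewrite ler_pdivrMr ?mulr_gt0// mulrC.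
Qed.

End vectors.

Lemma ler_norm_sub1 (R : realFieldType) (a b e : R) :
  1 - e <= a -> a <= 1 -> 1 - e <= b -> b <= 1 -> `|b - a| <= e.
Proof. by move=> *; rewrite ler_norml; apply/andP; split; lra. Qed.

(** * Differences of the symbol far from the origin and near it *)

Section difference_bound.
Variables (R : realType) (N : nat) (s : R).
Hypothesis s01 : 0 < s < 1.

(** On the segment xi + u h with 0 <= u <= k the norm stays at least |xi|/2, away from the
    singularity of the symbol at 0. The derivative bound then applies with m = (|xi|/2)^2 and eta =
    |h|. *)
Lemma iter_fdiffv_symb_far k : (1 < k)%N -> exists C : R, 0 <= C /\
  forall (t : R) (h xi : N.-tuple R), 0 < t -> 0 < normv h ->
    2 * k%:R * normv h <= normv xi ->
    `|iter k (fdiffv h) (symb s t) xi| <=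
    C * (t * normv h `^ (2 * s) * (normv xi / normv h / 2) `^ (2 * s - k%:R)).
Proof.
move=> k1; have [C [C0 hC]] := deriv_bound_expR_powR s01 k1.
exists C; split => // t h xi t0 r0 far.
rewrite -{1}(shiftv0 xi h) iter_fdiffv; set r := normv h in r0 far *.
have k0 : 0 < k%:R :> R by rewrite ltr0n ltnW.
pose q (u : R) := normv (shiftv xi u h) ^+ 2.
pose q1 (u : R) := 2 * dotv h (shiftv xi u h).
have x0 : 0 < normv xi by apply: lt_le_trans far; rewrite !mulr_gt0.
pose m := (normv xi / 2) ^+ 2.
have m0 : 0 < m by rewrite exprn_gt0// divr_gt0.
have dq (u : R) : is_derive u 1 q (q1 u).
  rewrite (_ : q = fun u => normv xi ^+ 2 + u * (2 * dotv xi h) + u ^+ 2 * r ^+ 2);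
    last by apply/funext => v; rewrite /q sqr_normv_shiftv.
  apply: (is_derive_eq (is_derive_quadratic _ _ _ _)).
  by rewrite /q1 dotv_shiftv dotvv -/r (dotvC h); ring.
have dq1 (u : R) : is_derive u 1 q1 (2 * r ^+ 2).
  rewrite (_ : q1 = fun u => 2 * dotv h xi + u * (2 * r ^+ 2)); last first.
    by apply/funext => v; rewrite /q1 dotv_shiftv dotvv -/r; ring.
  exact: is_derive_affine.
have main := hC t q q1 (2 * r ^+ 2) r m 0 (0 + k%:R) t0 (ltW r0) m0.
have {}main := iter_diff1_deriv_bound (main _ _).
rewrite [X in iter k _ X](_ : _ = fun x => expR (- (t * q x `^ s))); last first.
  by apply/funext => u; rewrite symbE.
apply: le_trans (main _ _) _.
- move=> u /andP[u0 uk]; split => //.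
  + rewrite /m /q lerXn2r ?nnegrE ?divr_ge0 ?normv_ge0//.
    apply: le_trans (normv_shiftv_ge _ _ _); rewrite ger0_norm//.
    have : u * normv h <= k%:R * normv h by rewrite ler_wpM2r ?normv_ge0// -(add0r k%:R).
    by rewrite -/r; lra.
  + rewrite /q1 normrM ger0_norm// -mulrA ler_wpM2l//.
    apply: (le_trans (ler_dotv _ _)).
    by rewrite /q powR12_sqrt ?sqr_ge0// sqrtr_sqr ger0_norm ?normv_ge0.
- by rewrite ger0_norm// mulr_ge0 ?exprn_ge0 ?ltW.
rewrite ler_wpM2l// -2!mulrA ler_wpM2l ?(ltW t0)//.
(* It remains to rewrite |h|^k (|xi|/2)^(2s-k) as |h|^(2s) (|xi|/|h|/2)^(2s-k). *)
rewrite /m -(powR_mulrn 2) ?divr_ge0 ?normv_ge0// -powRrM.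
rewrite (_ : 2%:R * (s - k%:R / 2) = 2 * s - k%:R); last by field.
rewrite (_ : normv xi / 2 = normv xi / r / 2 * r); last by field; rewrite gt_eqF.
rewrite powRM ?divr_ge0 ?normv_ge0// -?/r ?(ltW r0)//.
rewrite -(powR_mulrn k) ?(ltW r0)// mulrCA -powRD_pos// (_ : k%:R + _ = 2 * s); last by ring.
by rewrite mulrC.
Qed.

(** Near the origin derivatives may blow up. There the symbol lies between 1 - t M and 1, so one
    difference is at most t M, and each of the k others at most doubles the bound. *)
Lemma iter_fdiffv_symb_near k : exists C : R, 0 <= C /\
  forall (t : R) (h xi : N.-tuple R), 0 < t -> 0 < normv h ->
    normv xi <= 2 * k.+1%:R * normv h ->
    `|iter k.+1 (fdiffv h) (symb s t) xi| <= C * (t * normv h `^ (2 * s)).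
Proof.
(* The square dominates (3(k+1))^(2s), since s < 1. *)
exists (2 ^+ k * (3 * k.+1%:R) ^+ 2); split; first by rewrite mulr_ge0 ?sqr_ge0 ?exprn_ge0.
move=> t h xi t0 r0 near.
rewrite -{1}(shiftv0 xi h) iter_fdiffv; set r := normv h in r0 near *.
have s20 : 0 <= 2 * s by rewrite mulr_ge0//; case/andP: s01 => /ltW.
rewrite iterSr -mulrA; apply: iter_diff1_le => u /andP[u0 uk].
(* Every point met has norm at most |xi| + (k+1)|h| <= 3(k+1)|h|. *)
pose M := (3 * k.+1%:R * r) `^ (2 * s).
have close (v : R) : 0 <= v <= k.+1%:R -> 1 - t * M <= symb s t (shiftv xi v h) <= 1.
  move=> /andP[v0 vk]; rewrite symb_le1 ?(ltW t0)// andbT.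
  apply: (@le_trans _ _ (1 - t * normv (shiftv xi v h) `^ (2 * s))); last first.
    by have := expR_ge1Dx (- (t * normv (shiftv xi v h) `^ (2 * s))).
  rewrite lerB// ler_wpM2l ?(ltW t0)//.
  apply: (ge0_ler_powR s20); rewrite ?nnegrE ?normv_ge0 ?mulr_ge0 ?(ltW r0)//.
  apply: (le_trans (normv_shiftv_le _ _ _)); rewrite ger0_norm// -/r.
  by have := ler_wpM2r (ltW r0) vk; lra.
have /andP[a1 a2] : 1 - t * M <= symb s t (shiftv xi u h) <= 1.
  by apply: close; rewrite u0/=; move: uk; rewrite -natr1; lra.
have /andP[b1 b2] : 1 - t * M <= symb s t (shiftv xi (u + 1) h) <= 1.
  by apply: close; apply/andP; split; [lra|move: uk; rewrite -natr1; lra].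
apply: (@le_trans _ _ (t * M)); first exact: ler_norm_sub1 a1 a2 b1 b2.
rewrite mulrCA ler_wpM2l ?(ltW t0)// /M powRM ?mulr_ge0 ?(ltW r0)//.
rewrite ler_wpM2r ?powR_ge0// -powR_mulrn ?mulr_ge0// ler_powR//.
  by rewrite -natrM ler1n.
by rewrite -[leRHS]mulr1 ler_wpM2l// ltW//; case/andP: s01.
Qed.

(** The order N + 3 brings the far exponent 2s - (N+3) below -(N+1), because s < 1; this is the
    integrable decay of [jap]. *)
Lemma iter_fdiffv_symb_le_jap : exists C : R, 0 <= C /\
  forall (t : R) (h xi : N.-tuple R), 0 < t -> 0 < normv h ->
    `|iter N.+3 (fdiffv h) (symb s t) xi| <=
    C * (t * normv h `^ (2 * s)) * jap (normv h) xi.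
Proof.
have [//|C1 [C10 h1]] := @iter_fdiffv_symb_far N.+3.
have [C2 [C20 h2]] := iter_fdiffv_symb_near N.+2.
pose k : R := N.+3%:R.
have k1 : 1 <= k by rewrite ler1n.
have k2 : 0 <= 1 + 2 * k by lra.
(* With v = |xi|/|h|, the factor 3 comes from 1 + v <= 3 (v/2) in the far region, and 1 + 2k from v
   <= 2k in the near one. *)
exists (C1 * 3 ^+ N.+1 + C2 * (1 + 2 * k) ^+ N.+1).
split; first by rewrite addr_ge0// mulr_ge0 ?exprn_ge0.
move=> t h xi t0 r0; set r := normv h in r0 *.
have T0 : 0 <= t * r `^ (2 * s) by rewrite mulr_ge0 ?powR_ge0 ?ltW.
have J0 := ltW (jap_gt0 xi r0).
rewrite (mulrDl (C1 * _) (C2 * _)) (mulrDl (C1 * _ * _)).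
have [far|near] := leP (2 * k * r) (normv xi).
  apply: le_trans (h1 t h xi t0 r0 far) _; rewrite -/r.
  rewrite -[leLHS]addr0 lerD//; last by rewrite !mulr_ge0 ?powR_ge0 ?exprn_ge0 ?(ltW t0).
  rewrite -[leRHS]mulrA -[leRHS]mulrA ler_wpM2l// -/r [leRHS]mulrCA ler_wpM2l//.
  have v1 : 1 <= normv xi / r / 2.
    by rewrite ler_pdivlMr// mul1r ler_pdivlMr//; apply: le_trans far; nra.
  rewrite /jap ler_pdivlMr; last by rewrite exprn_gt0//; lra.
  apply: (@le_trans _ _ ((normv xi / r / 2) `^ (- N.+1%:R) *
      (3 * (normv xi / r / 2)) ^+ N.+1)).
    rewrite ler_pM ?powR_ge0 ?exprn_ge0//; first by lra.
      rewrite ler_powR//; case/andP: s01 => _.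
      by rewrite -[N.+3%:R]natr1 -natr1; lra.
    by rewrite lerXn2r ?nnegrE//; lra.
  rewrite exprMn mulrCA powRN powR_mulrn; last by lra.
  by rewrite mulVf ?mulr1// expf_neq0// gt_eqF//; lra.
apply: le_trans (h2 t h xi t0 r0 (ltW near)) _; rewrite -/r.
rewrite -[leLHS]add0r lerD//; first by rewrite !mulr_ge0 ?powR_ge0 ?exprn_ge0 ?(ltW t0).
rewrite [leRHS](_ : _ = C2 * (t * r `^ (2 * s)) * ((1 + 2 * k) ^+ N.+1 * jap r xi)); last by ring.
rewrite -[leLHS]mulr1 ler_wpM2l ?(mulr_ge0 C20 T0)//.
have b1 := jap_base_ge1 xi r0.
rewrite /jap ler_pdivlMr ?mul1r; last by rewrite exprn_gt0//; lra.
rewrite lerXn2r ?nnegrE; [by []|lra|lra|].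
by rewrite lerD2l ler_pdivrMr// ltW.
Qed.

End difference_bound.

(** * Lebesgue measure on tuples *)

Section measurability.
Variables (R : realType) (N : nat).
Implicit Types x y h xi a b : N.-tuple R.

Lemma measurable_normv : measurable_fun setT (@normv R N).
Proof.
rewrite (_ : @normv R N = fun x => (\sum_(i < N) tnth x i ^+ 2) `^ 2^-1).
  apply: (measurableT_comp (measurable_powR _)) => //.
  apply: measurable_sum => i; apply: measurable_funX; exact: measurable_tnth.
apply/funext => x; rewrite powR12_sqrt// sumr_ge0// => i _; exact: sqr_ge0.
Qed.

Lemma measurable_dotv x : measurable_fun setT (@dotv R N x).
Proof.
apply: measurable_sum => i; apply: measurable_funM => //.
exact: measurable_tnth.
Qed.

Lemma measurable_shiftv tau h : measurable_fun setT (fun x => shiftv x tau h).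
Proof.
apply/measurable_fun_tnthP => i.
rewrite (_ : _ \o _ = fun x => tnth x i + tau * tnth h i); last first.
  by apply/funext => x /=; rewrite tnth_mktuple.
by apply: measurable_funD => //; exact: measurable_tnth.
Qed.

Lemma measurable_symb s t : measurable_fun setT (@symb R N s t).
Proof.
apply: measurableT_comp => //; apply: measurableT_comp => //.
apply: measurable_funM => //; apply: (measurableT_comp (measurable_powR _)) => //.
exact: measurable_normv.
Qed.

Lemma japE r xi : 0 < r -> jap r xi = (1 + normv xi / r) `^ (- N.+1%:R).
Proof.
move=> r0; rewrite powRN powR_mulrn//.
exact: le_trans ler01 (jap_base_ge1 _ r0).
Qed.

Lemma measurable_jap r : 0 < r -> measurable_fun setT (@jap R N r).
Proof.
move=> r0; rewrite (_ : @jap R N r = fun xi => (1 + normv xi / r) `^ (- N.+1%:R)).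
  apply: (measurableT_comp (measurable_powR _)) => //.
  apply: measurable_funD => //; apply: measurable_funM => //.
  exact: measurable_normv.
by apply/funext => xi; rewrite japE.
Qed.

Lemma measurable_Phi s : measurable_fun setT (@Phi R N s).
Proof.
apply: measurable_fun_ifT => //.
  by apply: measurable_fun_ler => //; exact: measurable_normv.
apply: (measurableT_comp (measurable_powR _)) => //.
apply: measurable_funD => //; apply: measurable_funX; apply: measurable_funB => //.
by apply: measurable_funX; exact: measurable_normv.
Qed.

Definition box a b : set (N.-tuple R) :=
  [set x | forall i, tnth a i <= tnth x i <= tnth b i].

Lemma measurable_box a b : measurable (box a b).
Proof.
rewrite (_ : box a b = \big[setI/setT]_(i < N)
    ((fun x => tnth x i) @^-1` `[tnth a i, tnth b i])).
  apply: bigsetI_measurable => i _; rewrite -[X in measurable X]setTI.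
  by apply: measurable_tnth.
apply/seteqP; split => [x xab|x].
  rewrite -bigcap_seq => i _ /=; rewrite in_itv/=; exact: xab.
rewrite -bigcap_seq => xab i; have := xab i.
by rewrite /= in_itv/= mem_index_enum; apply.
Qed.

Definition cstv (c : R) : N.-tuple R := [tuple c | i < N].

Lemma ler_norm_tnth x i : `|tnth x i| <= normv x.
Proof.
rewrite -ler_sqr ?nnegrE ?normv_ge0// real_normK ?num_real// sqr_normv.
rewrite (bigD1 i)//= lerDl sumr_ge0// => j _; exact: sqr_ge0.
Qed.

Lemma ball_sub_box (rho : R) : [set x | normv x <= rho] `<=` box (cstv (- rho)) (cstv rho).
Proof.
move=> x /= xr i; rewrite !tnth_mktuple -ler_norml.
exact: le_trans (ler_norm_tnth _ _) xr.
Qed.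

Lemma measurable_normv_le rho : measurable [set x : N.-tuple R | normv x <= rho].
Proof.
rewrite -[X in measurable X]setTI.
rewrite [X in _ `&` X](_ : _ = @normv R N @^-1` `]-oo, rho]).
  by apply: measurable_normv.
by apply/seteqP; split => x /=; rewrite in_itv.
Qed.

Definition boxes : set (set (N.-tuple R)) := [set A | exists a b, A = box a b].

Lemma box_setI_closed : setI_closed boxes.
Proof.
move=> _ _ [a [b ->]] [a' [b' ->]].
exists [tuple Num.max (tnth a i) (tnth a' i) | i < N].
exists [tuple Num.min (tnth b i) (tnth b' i) | i < N].
apply/seteqP; split => [x [xa xb] i|x xab].
  by rewrite !tnth_mktuple ge_max le_min; case/andP: (xa i) => -> ->; case/andP: (xb i) => -> ->.
split=> i; have := xab i; rewrite !tnth_mktuple ge_max le_min;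
  by case/andP => /andP[? ?] /andP[? ?]; apply/andP.
Qed.

Lemma truncn_bound (c : R) : exists n : nat, `|c| <= n%:R.
Proof. by exists (Num.truncn `|c|).+1; rewrite ltW// truncnS_gt. Qed.

Lemma bigcup_box : \bigcup_n box (cstv (- n%:R)) (cstv n%:R) = setT.
Proof.
apply/seteqP; split => // x _.
have [n xn] := truncn_bound (normv x); exists n => //.
apply: ball_sub_box => /=; apply: le_trans xn; exact: ler_norm.
Qed.

(** Boxes are measurable; conversely a half-space x_i >= c is a countable union of boxes whose other
    sides grow to the whole line. *)
Lemma measurable_tuple_boxes :
  measurable = <<s boxes >> :> set (set (N.-tuple R)).
Proof.
apply/seteqP; split; last first.
  apply: smallest_sub; first exact: sigma_algebra_measurable.
  by move=> _ [a [b ->]]; exact: measurable_box.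
apply: smallest_sub; first exact: smallest_sigma_algebra.
rewrite -bigcup_seq => A [i _].
suff : measurable_fun setT (fun x : g_sigma_algebraType boxes => tnth x i).
  by move=> mi [B mB <-]; exact: mi.
apply: (measurability (@RGenCInfty.G R)); first exact: RGenCInfty.measurableE.
move=> _ [_ [c ->] <-]; rewrite setTI.
rewrite [X in measurable X](_ : _ = \bigcup_n
   box [tuple if j == i then c else - n%:R | j < N] (cstv n%:R)).
  apply: bigcupT_measurable => n; apply: sub_sigma_algebra.
  by eexists; eexists; reflexivity.
apply/seteqP; split => [x|x [n _ /(_ i)]]; rewrite /= in_itv/= andbT; last first.
  by rewrite tnth_mktuple eqxx => /andP[].
move=> cx; have [n xn] := truncn_bound (normv x); exists n => // j.
have /ball_sub_box/(_ j) : normv x <= n%:R by apply: le_trans xn; exact: ler_norm.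
by rewrite !tnth_mktuple; case: eqP => [->|//] /andP[_ ->]; rewrite cx.
Qed.

End measurability.

(** Presents the pushforward as a bundled measure, so that results on measures such as uniqueness
    apply to it. *)
Lemma pushforward_measure d d' (T : measurableType d) (T' : measurableType d')
    (R : realType) (mu : {measure set T -> \bar R}) (f : T -> T') :
  measurable_fun setT f ->
  exists nu : {measure set T' -> \bar R}, pushforward mu f = nu.
Proof.
move=> mf; unshelve eexists; first exact: (pushforward mu f).
by [].
Qed.

(** * Translation invariance and volume of balls *)

Section lebesgue.
Variables (R : realType) (N : nat).
Variable lam : {measure set (N.-tuple R) -> \bar R}.
Hypothesis lamE : is_lebesgue_measure lam.
Implicit Types x y h xi a b : N.-tuple R.

Lemma lebesgue_box_empty a b i : tnth b i < tnth a i -> box a b = set0.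
Proof.
move=> ba; rewrite -subset0 => x /(_ i) /andP[ax xb].
by have := lt_le_trans ba (le_trans ax xb); rewrite ltxx.
Qed.

Lemma preimage_shiftv_box a b h :
  (fun x => shiftv x 1 h) @^-1` box a b = box (shiftv a (-1) h) (shiftv b (-1) h).
Proof.
apply/seteqP; split => x xab i; have := xab i; rewrite !tnth_mktuple !mul1r !mulN1r.
  by rewrite lerBlDr lerBrDr.
by rewrite lerBlDr lerBrDr.
Qed.

Lemma lebesgue_shiftv_box a b h : lam (box (shiftv a (-1) h) (shiftv b (-1) h)) = lam (box a b).
Proof.
(* [lamE] speaks only of boxes with ordered corners; in the other case both boxes are empty. *)
have [ab|] := boolP [forall i, tnth a i <= tnth b i]; last first.
  rewrite negb_forall => /existsP[i]; rewrite -ltNge => ba.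
  by rewrite (lebesgue_box_empty ba) (@lebesgue_box_empty _ _ i)// !tnth_mktuple ltrD2r.
rewrite (lamE (forallP ab)) lamE; last first.
  by move=> i; rewrite !tnth_mktuple lerD2r; exact: (forallP ab).
by congr (_%:E); apply: eq_bigr => i _; rewrite !tnth_mktuple; ring.
Qed.

(** The image measure agrees with [lam] on boxes, a generating family closed under intersection, and
    the cubes [-n, n]^N have finite measure and exhaust the space; uniqueness of measures
    concludes. *)
Lemma lebesgue_shiftv h (A : set (N.-tuple R)) : measurable A ->
  lam ((fun x => shiftv x 1 h) @^-1` A) = lam A.
Proof.
have mh := measurable_shiftv 1 h.
have [m1 m1E] := pushforward_measure lam mh.
have {}m1E B : m1 B = lam ((fun x => shiftv x 1 h) @^-1` B) by rewrite -m1E.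
move=> mA; rewrite -m1E.
apply: (measure_unique (@boxes R N) (fun n => box (cstv N (- n%:R)) (cstv N n%:R))) => //.
- exact: measurable_tuple_boxes.
- exact: box_setI_closed.
- by move=> n; eexists; eexists; reflexivity.
- exact: bigcup_box.
- by move=> _ [a [b ->]]; rewrite m1E preimage_shiftv_box lebesgue_shiftv_box.
- move=> n; rewrite m1E preimage_shiftv_box lebesgue_shiftv_box lamE ?ltry//.
  by move=> i; rewrite !tnth_mktuple (@le_trans _ _ 0)// oppr_le0.
Qed.

Lemma lebesgue_ball_le (rho : R) : 0 <= rho ->
  (lam [set x | normv x <= rho]%R <= ((2 * rho) ^+ N)%:E)%E.
Proof.
move=> rho0; apply: (@le_trans _ _ (lam (box (cstv N (- rho)) (cstv N rho)))).
  by apply: le_measure; rewrite ?inE;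
    [exact: measurable_normv_le|exact: measurable_box|exact: ball_sub_box].
rewrite lamE; last by move=> i; rewrite !tnth_mktuple; lra.
rewrite lee_fin (eq_bigr (fun=> 2 * rho)).
  by rewrite prodr_const card_ord.
by move=> i _; rewrite !tnth_mktuple; ring.
Qed.

End lebesgue.

(** * Comparison of integrals and the integral of the bracket by dyadic layers *)

Lemma dyadic_ge1 (R : realType) (w : R) : 1 <= w ->
  exists n, 2 ^+ n <= w <= 2 ^+ n.+1.
Proof.
move=> w1.
have ex : exists n, w <= 2 ^+ n.+1.
  exists (Num.truncn w).+1; apply: le_trans (ltW (truncnS_gt w)) _.
  by rewrite -natrX ler_nat ltnW// (leq_trans (ltn_expl _ (ltnSn 1)))// leq_exp2l.
case: (ex_minnP ex) => -[|n] wn hmin; first by exists 0%N; rewrite expr0 w1.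
exists n.+1; rewrite wn andbT leNgt; apply/negP => /ltW/hmin.
by rewrite ltnn.
Qed.

(** The integral of f is at most that of its positive part, and nonnegative integrals are suprema
    over the simple functions below. This compares the integral of the kernel against [mu0] without
    first proving the kernel measurable. *)
Lemma le_integral_nonmeasurable d (T : measurableType d) (R : realType)
    (mu : {measure set T -> \bar R}) (f g : T -> \bar R) :
  (forall x, (0 <= g x)%E) -> (forall x, (f x <= g x)%E) ->
  (\int[mu]_(x in setT) f x <= \int[mu]_(x in setT) g x)%E.
Proof.
move=> g0 fg; rewrite integralE.
apply: (@le_trans _ _ (\int[mu]_(x in setT) (f^\+ x))%E).
  by rewrite -[leRHS]adde0 leeD2l// oppe_le0 integral_ge0.
rewrite !ge0_integralTE//; apply: le_ereal_sup => _ [h hf <-].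
exists h => // x; apply: le_trans (hf x) _.
by rewrite funeposE ge_max fg g0.
Qed.

Section kernel.
Variables (R : realType) (N : nat).
Variable lam : {measure set (N.-tuple R) -> \bar R}.
Hypothesis lamE : is_lebesgue_measure lam.
Implicit Types x y h xi a b : N.-tuple R.

(** The bracket is dominated by the sum over j of 2^(-j(N+1)) times the indicator of the ball of
    radius 2^(j+1) r; the integrals of the terms are bounded by a geometric series of ratio 1/2. *)
Lemma integral_jap_le (r : R) : 0 < r ->
  (\int[lam]_(xi in setT) (jap r xi)%:E <= (2 * (4 * r) ^+ N)%:E)%E.
Proof.
move=> r0; pose z : R := 2 ^- N.+1.
have z0 : 0 <= z by rewrite invr_ge0 exprn_ge0.
pose B j : set (N.-tuple R) := [set xi | normv xi <= 2 ^+ j.+1 * r].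
have mB j : measurable (B j) := measurable_normv_le _.
pose u j xi : \bar R := ((z ^+ j)%R%:E * (\1_(B j) xi)%:E)%E.
have u0 j xi : (0 <= u j xi)%E by rewrite mule_ge0// lee_fin ?exprn_ge0.
have mu1 j : measurable_fun setT (fun xi => (\1_(B j) xi : R)%:E).
  by apply/measurable_EFinP; exact: measurable_indic.
have mu j : measurable_fun setT (u j) := measurable_funeM _ (mu1 j).
apply: (@le_trans _ _ (\int[lam]_(xi in setT) \sum_(j <oo) u j xi)%E).
  apply: le_integral_nonmeasurable => xi; first by apply: nneseries_ge0.
  have w1 := jap_base_ge1 xi r0.
  have [n /andP[nw wn]] := dyadic_ge1 w1.
  (* One term of the series suffices, the one with 2^n <= 1 + |xi|/r <= 2^(n+1). *)
  apply: (@le_trans _ _ (u n xi)).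
    rewrite /u indicE mem_set; last first.
      rewrite /B /=; have : normv xi / r <= 2 ^+ n.+1 by lra.
      by rewrite ler_pdivrMr.
    rewrite mule1 lee_fin /jap /z exprVn -exprM mulnC exprM lef_pV2 ?posrE ?exprn_gt0//.
      by rewrite lerXn2r ?nnegrE ?exprn_ge0//; lra.
    by lra.
  apply: le_trans (nneseries_lim_ge n.+1 _) => //.
  by rewrite big_nat_recr//= leeDr// sume_ge0.
rewrite integral_nneseries//.
apply: lime_le.
  by apply: is_cvg_nneseries => j _ _; apply: integral_ge0 => xi _.
apply: nearW => n.
apply: (@le_trans _ _ (\sum_(0 <= j < n) ((4 * r) ^+ N * 2^-1 ^+ j)%:E)%E).
  apply: lee_sum => j _.
  rewrite ge0_integralZl_EFin ?exprn_ge0//.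
  rewrite integral_indic// setIT.
  apply: (@le_trans _ _ ((z ^+ j)%:E * ((2 * (2 ^+ j.+1 * r)) ^+ N)%:E)%E).
    by rewrite lee_wpmul2l ?lee_fin ?exprn_ge0// lebesgue_ball_le// mulr_ge0 ?exprn_ge0 ?ltW.
  (* The weight 2^(-j(N+1)) beats the volume growth 2^(jN) and leaves 2^(-j). *)
  rewrite -EFinM lee_fin le_eqVlt; apply/orP; left; apply/eqP.
  have -> : 2 * (2 ^+ j.+1 * r) = (4 * r) * 2 ^+ j by rewrite exprS; ring.
  rewrite exprMn mulrCA; congr (_ * _).
  rewrite /z -exprVn exprAC exprS -mulrA -!exprMn mulVf//.
  by rewrite !expr1n mulr1.
rewrite sumEFin lee_fin -mulr_sumr mulrC ler_wpM2r ?exprn_ge0 ?mulr_ge0 ?(ltW r0)//.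
have := @geometric_le_lim R n 1 2^-1 ler01.
rewrite invr_gt0 ltr0n ger0_norm ?invr_ge0// invf_lt1// ltr1n => /(_ isT isT).
rewrite /series/= /geometric/= (_ : 1 / (1 - 2^-1) = 2); last by field.
by under eq_bigr do rewrite mul1r.
Qed.

End kernel.

(** * The kernel *)

Section kernel.
Variables (R : realType) (N : nat).
Variable lam : {measure set (N.-tuple R) -> \bar R}.
Hypothesis lamE : is_lebesgue_measure lam.
Implicit Types (x y h xi : N.-tuple R) (f : N.-tuple R -> R).

(** For [f] the symbol this is the kernel without its factor (2 pi)^(-N); a general [f] gives room
    for the differences of the symbol. *)
Definition cosint x f : R := Rintegral lam setT (fun xi => cos (dotv x xi) * f xi).

Lemma measurable_cosdot x : measurable_fun setT (fun xi => cos (dotv x xi)).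
Proof.
apply: measurableT_comp; last exact: measurable_dotv.
exact: (continuous_measurable_fun (@continuous_cos R)).
Qed.

Lemma integrable_cosM x f : lam.-integrable setT (EFin \o f) ->
  lam.-integrable setT (EFin \o (fun xi => cos (dotv x xi) * f xi)).
Proof.
move=> fi; apply: (le_integrable measurableT _ _ fi).
  apply/measurable_EFinP; apply: measurable_funM; first exact: measurable_cosdot.
  by apply/measurable_EFinP; case/integrableP: fi.
move=> xi _ /=; rewrite lee_fin normrM ler_piMl// ler_norml.
by rewrite cos_geN1 cos_le1.
Qed.

Lemma integrable_jap r : 0 < r -> lam.-integrable setT (EFin \o @jap R N r).
Proof.
move=> r0; apply/integrableP; split.
  by apply/measurable_EFinP; exact: measurable_jap.
under eq_integral => xi _ do rewrite gee0_abs ?lee_fin ?(ltW (jap_gt0 _ r0))//.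
exact: le_lt_trans (integral_jap_le lamE r0) (ltry _).
Qed.

Lemma integrable_le_jap r M f : 0 < r -> measurable_fun setT f ->
  (forall xi, `|f xi| <= M * jap r xi) -> lam.-integrable setT (EFin \o f).
Proof.
move=> r0 mf fM; have ji := integrableZl measurableT M (integrable_jap r0).
apply: (le_integrable measurableT _ _ ji); first exact/measurable_EFinP.
by move=> xi _ /=; rewrite lee_fin (le_trans (fM xi))// ler_norm.
Qed.

Lemma cosint_le x r M f : 0 < r -> 0 <= M -> measurable_fun setT f ->
  (forall xi, `|f xi| <= M * jap r xi) ->
  `|cosint x f| <= M * (2 * (4 * r) ^+ N).
Proof.
move=> r0 M0 mf fM.
have ci := integrable_cosM x (integrable_le_jap r0 mf fM).
rewrite -lee_fin /cosint EFin_normr_Rintegral//.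
apply: (le_trans (le_abse_integral _ _ _)) => //; first by case/integrableP: ci.
apply: (@le_trans _ _ (\int[lam]_(xi in setT) (M%:E * (jap r xi)%:E))%E).
  apply: le_integral_nonmeasurable => xi /=.
    by rewrite -EFinM lee_fin mulr_ge0// ltW// jap_gt0.
  rewrite -EFinM lee_fin (le_trans _ (fM xi))// normrM ler_piMl// ler_norml.
  by rewrite cos_geN1 cos_le1.
rewrite ge0_integralZl_EFin//.
- by rewrite EFinM lee_wpmul2l ?lee_fin// integral_jap_le.
- by move=> xi _; rewrite lee_fin ltW// jap_gt0.
- by apply/measurable_EFinP; exact: measurable_jap.
Qed.

(** Proved on |f| by the nonnegative change of variables, because the signed one in
    [Rintegral_shiftv] presupposes that the translate is integrable. *)
Lemma integrable_shiftv h f : lam.-integrable setT (EFin \o f) ->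
  lam.-integrable setT (EFin \o (fun xi => f (shiftv xi 1 h))).
Proof.
move=> fi; have mf : measurable_fun setT f.
  by apply/measurable_EFinP; case/integrableP: fi.
have mh := measurable_shiftv 1 h.
apply/integrableP; split.
  by apply/measurable_EFinP; exact: (measurableT_comp mf mh).
have mff : measurable_fun setT (fun xi => `|(EFin \o f) xi|%E).
  by apply: measurableT_comp => //; apply/measurable_EFinP.
have ff0 : {in setT, forall xi, (0 <= `|(EFin \o f) xi|)%E} by [].
have := ge0_integral_pushforward mh lam measurableT mff ff0.
rewrite preimage_setT => <-; case/integrableP: fi => _; apply: le_lt_trans.
rewrite le_eqVlt; apply/orP; left; apply/eqP.
have [m1 m1E] := pushforward_measure lam mh.
rewrite m1E; apply: eq_measure_integral => A mA _.
by rewrite -m1E /pushforward (lebesgue_shiftv lamE).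
Qed.

Lemma Rintegral_shiftv h f : lam.-integrable setT (EFin \o f) ->
  Rintegral lam setT (fun xi => f (shiftv xi 1 h)) = Rintegral lam setT f.
Proof.
move=> fi; have mf : measurable_fun setT (EFin \o f) by case/integrableP: fi.
have mh := measurable_shiftv 1 h.
rewrite /Rintegral; congr fine.
transitivity (\int[pushforward lam (fun xi => shiftv xi 1 h)]_x (EFin \o f) x)%E.
  have fi' : lam.-integrable ((fun xi => shiftv xi 1 h) @^-1` setT)
      ((EFin \o f) \o (fun xi => shiftv xi 1 h)).
    by rewrite preimage_setT; exact: integrable_shiftv.
  by rewrite (integral_pushforward mh mf fi')// preimage_setT.
have [m1 m1E] := pushforward_measure lam mh.
rewrite m1E; apply: eq_measure_integral => A mA _.
by rewrite -m1E /pushforward (lebesgue_shiftv lamE).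
Qed.

Lemma integrable_fdiffv h f : lam.-integrable setT (EFin \o f) ->
  lam.-integrable setT (EFin \o fdiffv h f).
Proof.
by move=> fi; have := integrableB measurableT (integrable_shiftv h fi) fi.
Qed.

(* Translating by half a period of the oscillating factor flips its sign. *)
Lemma cosint_fdiffv x h f : dotv x h = pi -> lam.-integrable setT (EFin \o f) ->
  cosint x (fdiffv h f) = - 2 * cosint x f.
Proof.
move=> xh fi; have ci := integrable_cosM x fi.
have si := integrable_cosM x (integrable_shiftv h fi).
rewrite /cosint /fdiffv.
under eq_Rintegral do rewrite mulrBr.
rewrite RintegralB//.
rewrite (_ : Rintegral lam setT (fun xi => cos (dotv x xi) * f (shiftv xi 1 h)) =
  - Rintegral lam setT (fun xi => cos (dotv x xi) * f xi)); first by ring.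
(* The whole integrand on the right is translated, which turns its cosine into cos(x.xi + pi) =
   -cos(x.xi). *)
rewrite -[in RHS](Rintegral_shiftv h ci) -[RHS]mulN1r -RintegralZl//; last first.
  exact: (integrable_shiftv h ci).
apply: eq_Rintegral => xi _.
by rewrite dotv_shiftv mul1r xh cosDpi; ring.
Qed.

Lemma cosint_iter_fdiffv k x h f : dotv x h = pi -> lam.-integrable setT (EFin \o f) ->
  lam.-integrable setT (EFin \o iter k (fdiffv h) f) /\
  cosint x (iter k (fdiffv h) f) = (- 2) ^+ k * cosint x f.
Proof.
move=> xh fi; elim: k => [|k [IHi IH]]; first by rewrite expr0 mul1r.
split; first exact: integrable_fdiffv.
by rewrite iterS cosint_fdiffv// IH exprS mulrA.
Qed.

Lemma frac_heat_kernelE s t x :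
  frac_heat_kernel lam s t x = ((2 * pi)^-1) ^+ N * cosint x (symb s t).
Proof. by []. Qed.

(** * The two bounds on the cosine transform of the symbol *)

Variable s : R.
Hypothesis s01 : 0 < s < 1.

(** The symbol is bounded by a bracket of scale r = t^(-1/(2s)), whose integral is of order r^N. *)
Lemma cosint_symb_le_t : exists C : R, 0 <= C /\ forall (t : R) x, 0 < t ->
  cosint x (symb s t) <= C * t `^ (- (N%:R / (2 * s))).
Proof.
have s0 : 0 < s by case/andP: s01.
have [C [C0 hC]] := symb_le_jap N s0.
exists (C * (2 * 4 ^+ N)); split; first by rewrite !mulr_ge0 ?exprn_ge0.
move=> t x t0; pose r := t `^ (- (2 * s)^-1).
have r0 : 0 < r by rewrite powR_gt0.
have -> : t `^ (- (N%:R / (2 * s))) = r ^+ N.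
  rewrite -powR_mulrn ?powR_ge0// -powRrM; congr (_ `^ _); by rewrite mulrC mulNr.
apply: (le_trans (ler_norm _)).
rewrite -mulrA -(mulrA 2) -exprMn.
apply: cosint_le => //; first exact: measurable_symb.
by move=> xi; rewrite ger0_norm ?symb_ge0// hC.
Qed.

Lemma cosint_symb_le_x : exists C : R, 0 <= C /\
  forall (t : R) x, 0 < t -> 0 < normv x ->
  cosint x (symb s t) <= C * (t * normv x `^ (- (N%:R + 2 * s))).
Proof.
have s0 : 0 < s by case/andP: s01.
have [C [C0 hC]] := iter_fdiffv_symb_le_jap N s01.
have [C' [_ hC']] := symb_le_jap N s0.
(* The factor 2 4^N comes from the integral of the bracket, the power of pi from |h|^(N+2s) with |h|
   = pi/|x|. *)
exists (C * (2 * 4 ^+ N) * pi `^ (N%:R + 2 * s)).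
split; first by rewrite !mulr_ge0 ?exprn_ge0 ?powR_ge0.
move=> t x t0 x0.
(* The shortest vector with x.h = pi. *)
pose h : N.-tuple R := [tuple pi / normv x ^+ 2 * tnth x i | i < N].
have xh : dotv x h = pi by rewrite dotv_scale dotvv divfK// expf_neq0// gt_eqF.
have hx : normv h = pi / normv x.
  rewrite normv_scale ger0_norm ?divr_ge0 ?exprn_ge0 ?pi_ge0 ?normv_ge0//.
  by field; rewrite gt_eqF.
have r0 : 0 < normv h by rewrite hx divr_gt0// pi_gt0.
have si : lam.-integrable setT (EFin \o (@symb R N s t)).
  apply: (@integrable_le_jap (t `^ (- (2 * s)^-1)) C'); rewrite ?powR_gt0//.
    exact: measurable_symb.
  by move=> xi; rewrite ger0_norm ?symb_ge0// hC'.
have [ii iE] := cosint_iter_fdiffv N.+3 xh si.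
have mi : measurable_fun setT (iter N.+3 (fdiffv h) (@symb R N s t)).
  by apply/measurable_EFinP; case/integrableP: ii.
have T0 : 0 <= t * normv h `^ (2 * s) by rewrite mulr_ge0 ?powR_ge0 ?ltW.
have := cosint_le x r0 (mulr_ge0 C0 T0) mi (fun xi => hC t h xi t0 r0).
rewrite iE normrM normrX normrN (ger0_norm (ler0n _ 2)) => H.
have {}H : cosint x (symb s t) <= C * (t * normv h `^ (2 * s)) * (2 * (4 * normv h) ^+ N).
  apply: le_trans H; apply: (le_trans (ler_norm _)).
  (* The factor 2^(N+3) gained from the differences is at least 1 and is dropped. *)
  by rewrite ler_peMl// exprn_ege1// ler1n.
apply: (le_trans H); rewrite le_eqVlt; apply/orP; left; apply/eqP.
rewrite exprMn -(powR_mulrn N (ltW r0)).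
have -> : normv x `^ (- (N%:R + 2 * s)) = (normv x)^-1 `^ (N%:R + 2 * s).
  by rewrite -powR_inv1 ?normv_ge0// -powRrM mulN1r.
have -> : pi `^ (N%:R + 2 * s) = normv h `^ (N%:R + 2 * s) * normv x `^ (N%:R + 2 * s).
  rewrite -powRM ?(ltW r0) ?normv_ge0//; congr (_ `^ _).
  by rewrite hx divfK// gt_eqF.
rewrite (powRD_pos _ _ r0).
have xx : normv x `^ (N%:R + 2 * s) * (normv x)^-1 `^ (N%:R + 2 * s) = 1.
  by rewrite -powRM ?invr_ge0 ?normv_ge0// divff ?gt_eqF// powR1.
transitivity (C * (2 * 4 ^+ N) * (normv h `^ N%:R * normv h `^ (2 * s)) * t *
  (normv x `^ (N%:R + 2 * s) * (normv x)^-1 `^ (N%:R + 2 * s))); last by ring.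
by rewrite xx; ring.
Qed.

End kernel.

(** * Pointwise bound on the kernel *)

(** The bound in t serves |z| <= 1, where (1+|z|)/2 <= 1; the bound in z serves |z| > 1, where
    (1+|z|)/2 <= |z|. The halves account for the factor 2^p. *)
Lemma frac_heat_kernel_le (R : realType) (N : nat)
    (lam : {measure set (N.-tuple R) -> \bar R}) (s : R) :
  is_lebesgue_measure lam -> 0 < s < 1 ->
  exists C : R, 0 <= C /\ forall (t : R) (z : N.-tuple R), 0 < t ->
    frac_heat_kernel lam s t z <= C *
      ((t `^ (- (N%:R / (2 * s))) + t) * (1 + normv z) `^ (- (N%:R + 2 * s))).
Proof.
move=> lamE s01; have s0 : 0 < s by case/andP: s01.
have [A [A0 hA]] := cosint_symb_le_t lamE s01.
have [B [B0 hB]] := cosint_symb_le_x lamE s01.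
pose p := N%:R + 2 * s.
have one_powR : 1 `^ (- p) = 1 :> R by rewrite powR1.
have p0 : - p <= 0 by rewrite oppr_le0 addr_ge0 ?mulr_ge0 ?(ltW s0).
have c0 : 0 <= (2 * pi)^-1 ^+ N :> R.
  by rewrite exprn_ge0// invr_ge0 mulr_ge0// pi_ge0.
exists ((2 * pi)^-1 ^+ N * ((A + B) * 2 `^ p)).
split; first by rewrite mulr_ge0// mulr_ge0 ?powR_ge0 ?addr_ge0.
move=> t z t0; rewrite frac_heat_kernelE -mulrA ler_wpM2l// -/p.
have z0 := normv_ge0 z.
set T := t `^ (- (N%:R / (2 * s))); have T0 : 0 <= T by exact: powR_ge0.
have hW : 2 `^ p * (1 + normv z) `^ (- p) = ((1 + normv z) / 2) `^ (- p).
  rewrite powRM ?invr_ge0 ?addr_ge0// mulrC; congr (_ * _).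
  by rewrite -powR_inv1// -powRrM mulN1r opprK.
rewrite (_ : _ * _ * _ = (A + B) * (T + t) * (2 `^ p * (1 + normv z) `^ (- p))); last by ring.
rewrite hW.
have [z1|z1] := leP (normv z) 1.
  apply: (le_trans (hA t z t0)); rewrite -/T -[leLHS]mulr1 ler_pM//.
  - exact: mulr_ge0.
  - by rewrite ler_pM// ?lerDl// ltW.
  - rewrite -[leLHS]one_powR ler_powR_neg//; lra.
apply: (le_trans (hB t z t0 (lt_trans ltr01 z1))); rewrite -/p mulrA ler_pM ?powR_ge0//.
- by rewrite mulr_ge0// ltW.
- by rewrite ler_pM// ?lerDr// ltW.
- by rewrite ler_powR_neg//; lra.
Qed.

Lemma superadditive_exprn (R : realDomainType) (a : R) n : 0 <= a ->
  1 + a ^+ n.+1 <= (1 + a) ^+ n.+1.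
Proof.
move=> a0; elim: n => [|n IH]; first by rewrite !expr1.
rewrite [leRHS]exprS; apply: (@le_trans _ _ ((1 + a) * (1 + a ^+ n.+1))).
  by rewrite mulrDl mul1r mulrDr mulr1 -exprS -addrA lerD2l [leRHS]addrA lerDr addr_ge0// exprn_ge0.
by rewrite ler_wpM2l// addr_ge0.
Qed.

(** * Comparison of the weights *)

Section weight.
Variables (R : realType) (N : nat) (s : R).
Hypothesis s0 : 0 <= s.

Lemma Phi_ge0 (y : N.-tuple R) : 0 <= Phi s y.
Proof. by rewrite /Phi; case: ifP => // _; exact: powR_ge0. Qed.

(** Outside the unit ball, 1 + (|y|^2 - 1)^4 <= 1 + |y|^8 <= (1 + |y|)^8, and the exponent -p/8
    reverses the order. *)
Lemma powR_le_Phi (y : N.-tuple R) : (1 + normv y) `^ (- (N%:R + 2 * s)) <= Phi s y.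
Proof.
set p := N%:R + 2 * s; have y0 := normv_ge0 y.
have p0 : 0 <= p by rewrite addr_ge0 ?mulr_ge0.
have one_powR : 1 `^ (- p) = 1 :> R by rewrite powR1.
have np0 : - p <= 0 by rewrite oppr_le0.
rewrite /Phi -/p; case: ifPn => [_|]; rewrite -?ltNge.
  by rewrite -[leRHS]one_powR ler_powR_neg//; lra.
move=> y1; have -> : - p = 8%:R * - (p / 8) by field.
rewrite powRrM powR_mulrn ?addr_ge0// ler_powR_neg//.
- by rewrite ltr_wpDr// exprn_ge0// subr_ge0 exprn_ege1// ltW.
- have v0 : 0 <= normv y ^+ 2 - 1 by rewrite subr_ge0 exprn_ege1// ltW.
  have h : (normv y ^+ 2 - 1) ^+ 4 <= normv y ^+ 8.
    rewrite (_ : normv y ^+ 8 = (normv y ^+ 2) ^+ 4); last by rewrite -exprM.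
    by rewrite lerXn2r ?nnegrE ?sqr_ge0// gerBl.
  apply: (le_trans (lerD (lexx 1) h)).
  exact: superadditive_exprn.
- by rewrite oppr_le0 divr_ge0.
Qed.

(** Peetre's inequality, which follows from 1 + |y| <= (1 + |x|)(1 + |x-y|). *)
Lemma powR_subv_le (x y : N.-tuple R) (p : R) : 0 <= p ->
  (1 + normv (subv x y)) `^ (- p) <= (1 + normv x) `^ p * (1 + normv y) `^ (- p).
Proof.
move=> p0; set z := subv x y.
have x0 := normv_ge0 x; have y0 := normv_ge0 y; have z0 := normv_ge0 z.
have yxz : normv y <= normv x + normv z.
  have -> : y = shiftv x (-1) z.
    by apply: eq_from_tnth => i; rewrite !tnth_mktuple mulN1r opprB addrC subrK.
  by apply: (le_trans (normv_shiftv_le _ _ _)); rewrite normrN normr1 mul1r.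
have h : ((1 + normv x) * (1 + normv z)) `^ (- p) <= (1 + normv y) `^ (- p).
  apply: ler_powR_neg; [by lra|by nra|by rewrite oppr_le0].
have xp : 0 < (1 + normv x) `^ p by rewrite powR_gt0; lra.
rewrite -ler_pdivrMl// mulrC -powRN mulrC -powRM ?addr_ge0//.
Qed.

End weight.

(** * Integration of the kernel bound against the initial measure *)

Theorem theorem7p1 (R : realType) (N : nat) (s : R)
    (lam : {measure set (N.-tuple R) -> \bar R}) :
  (1 <= N)%N -> 0 < s < 1 -> is_lebesgue_measure lam ->
  exists C : R,
    forall mu0 : {measure set (N.-tuple R) -> \bar R},
      in_Ms_plus s mu0 ->
      forall (t : R) (x : N.-tuple R), 0 < t ->
        (frac_heat_sol lam mu0 s t x <=
         C%:E * Phi_norm s mu0 *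
         ((t `^ (- (N%:R / (2 * s))) + t) *
          (1 + normv x) `^ (N%:R + 2 * s))%:E)%E.
Proof.
move=> _ s01 lamE; have s0 : 0 <= s by case/andP: s01 => /ltW.
have [C [C0 hC]] := frac_heat_kernel_le lamE s01.
exists C => mu0 _ t x t0.
set T := t `^ _ + t; set p := N%:R + 2 * s.
have T0 : 0 <= T by rewrite addr_ge0 ?powR_ge0 ?ltW.
have p0 : 0 <= p by rewrite addr_ge0 ?mulr_ge0.
set X := (1 + normv x) `^ p; have X0 : 0 <= X by exact: powR_ge0.
have K0 : 0 <= C * (T * X) by rewrite !mulr_ge0.
(* The kernel is at most a multiple of [Phi] at y, and the multiple depends on t and x only, so it
   leaves the integral. *)
apply: (@le_trans _ _ (\int[mu0]_(y in setT) ((C * (T * X))%:E * (Phi s y)%:E))%E).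
  apply: le_integral_nonmeasurable => y.
    by rewrite -EFinM lee_fin mulr_ge0// Phi_ge0.
  rewrite -EFinM lee_fin; apply: (le_trans (hC _ _ t0)).
  rewrite -/T -/p -!mulrA ler_wpM2l// ler_wpM2l//.
  apply: (le_trans (powR_subv_le _ _ p0)); rewrite -/X ler_wpM2l//.
  exact: powR_le_Phi.
rewrite ge0_integralZl_EFin//.
- by rewrite -/(Phi_norm s mu0) EFinM muleAC.
- by move=> y _; rewrite lee_fin Phi_ge0.
- by apply/measurable_EFinP; exact: measurable_Phi.
Qed.
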